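(* Let $\boldsymbol{k}=(k_1,\dots,k_r)$ be an index with $k_1,k_r\geqslant2$. Then $$\mathcal T_*^T(\boldsymbol{k};s)=\mathcal T(\boldsymbol{k};s)$$ for every $T\in\mathbb C$ and every $s\neq0$ with $|\operatorname{Re}(s)|<\tfrac12$. In particular, the left-hand side is independent of $T$.
   Context: An index is a finite sequence $\boldsymbol{k}=(k_1,\dots,k_r)$ of positive integers, of depth $r$ and weight $|\boldsymbol{k}|=k_1+\cdots+k_r$; the empty index is $\varnothing$ (weight $0$). Reversal: $\overleftarrow{\boldsymbol{k}}=(k_r,\dots,k_1)$. Write $\boldsymbol{k}_{[1,j]}=(k_1,\dots,k_j)$, $\boldsymbol{k}_{(j,r]}=(k_{j+1},\dots,k_r)$, $\boldsymbol{k}_{[1,j)}=(k_1,\dots,k_{j-1})$, with $\boldsymbol{k}_{[1,0]}=\boldsymbol{k}_{(r,r]}=\boldsymbol{k}_{[1,1)}=\varnothing$. An index is admissible if it is empty or its last entry is $\geqslant2$. For $k_1,k_r\geqslant2$ and $s\in\mathbb C\setminus\mathbb Z$, the convergent multitangent function is the absolutely convergent series $\mathcal T(\boldsymbol{k};s)=\sum_{-\infty<n_1<\cdots<n_r<\infty}\prod_{i=1}^r(n_i+s)^{-k_i}$. Stuffle regularization. For a nonempty admissible index $\boldsymbol{a}=(a_1,\dots,a_d)$, $\zeta(\boldsymbol{a};s)=\sum_{0<n_1<\cdots<n_d}\prod_{i}(n_i+s)^{-a_i}$, and $\zeta(\varnothing;s)=1$. On the $\mathbb Q$-span $\mathfrak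 H^1_*$ of all indices, the stuffle product $*$ is bilinear with unit $\varnothing$ and $(a,\boldsymbol{\alpha})*(b,\boldsymbol{\beta})=(a,\boldsymbol{\alpha}*(b,\boldsymbol{\beta}))+(b,(a,\boldsymbol{\alpha})*\boldsymbol{\beta})+(a+b,\boldsymbol{\alpha}*\boldsymbol{\beta})$; $\mathfrak H^0_*$ is the span of admissible indices. It is known that every index of depth $r$ has a unique decomposition $\boldsymbol{k}=\sum_{l=0}^r\boldsymbol{u}_l*(1)^{*l}$ with $\boldsymbol{u}_l\in\mathfrak H^0_*$. Define $\zeta_*^X(\boldsymbol{k};s)=\sum_{l=0}^r\zeta(\boldsymbol{u}_l;s)X^l$ (with $\zeta(\cdot;s)$ extended linearly); equivalently, $\zeta_*^X(\cdot;s)$ is the unique stuffle homomorphism extending $\zeta(\cdot;s)$ on admissible indices with $\zeta_*^X(1;s)=X$. Harmonic number function: $H(s)=\int_0^1\frac{1-t^s}{1-t}\,dt=\psi(1+s)+\gamma=\sum_{n\geqslant1}\bigl(\frac1n-\frac1{n+s}\bigr)$, extended meromorphically to $\mathbb C$. Regularized multitangent function: $$\mathcal T_*^T(\boldsymbol{k};s)=\sum_{j=0}^{r}(-1)^{|\boldsymbol{k}_{[1,j]}|}\zeta_*^{T-H(-s)}(\overleftarrow{\boldsymbol{k}_{[1,j]}};-s)\,\zeta_*^{T-H(s)}(\boldsymbol{k}_{(j,r]};s)+\sum_{j=1}^{r}\frac{(-1)^{|\boldsymbol{k}_{[1,j)}|}}{s^{k_j}}\zeta_*^{T-H(-s)}(\overleftarrow{\boldsymbol{k}_{[1,j)}};-s)\,\zeta_*^{T-H(s)}(\boldsymbol{k}_{(j,r]};s),$$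 with empty-index factors equal to $1$. *)

(* Defs.v *)
From HB Require Import structures.
From mathcomp Require Import all_boot all_order all_algebra finmap.
(* The notations of monalg clash with those of MathComp-Analysis. *)
From mathcomp Require Export -(notations) monalg.
From mathcomp Require Import all_classical all_reals all_analysis.
From mathcomp Require Import complex.
From mathcomp.analysis.showcase Require summability.

Set Implicit Arguments.
Unset Strict Implicit.
Unset Printing Implicit Defensive.

Import Order.TTheory GRing.Theory Num.Theory numFieldNormedType.Exports.

Local Open Scope classical_set_scope.
Local Open Scope ring_scope.

HB.instance Definition _ (R : realType) := NormedModule.copy R[i] R[i]^o.

(* Indices are sequences of naturals satisfying is_index; empty index [::],
   depth size k, weight sumn k, reversal rev k, k_[1,j] = take j k,
   k_(j,r] = drop j k. Entries of sequences are numbered from 0, so that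
   k_j is nth 0 k j.-1. *)
Definition is_index (k : seq nat) : bool := all (fun a => 0 < a)%N k.

Definition admissible (k : seq nat) : bool :=
  is_index k && ((k == [::]) || (2 <= last 0 k)%N).

(* Q-span of words in nat. The span of all indices is the subspace supported
   on is_index; the stuffle product preserves it. *)
Notation word_space := (malg (seq nat) rat).

Definition word (k : seq nat) : word_space := mkmalgU k 1.

Definition prepend (a : nat) (u : word_space) : word_space :=
  \sum_(w <- msupp u) mcoeff w u *: word (a :: w).

Fixpoint stuffle_word (v : seq nat) : seq nat -> word_space :=
  match v with
  | [::] => word
  | a :: v' =>
      fix stuffle_v (w : seq nat) : word_space :=
        match w with
        | [::] => word v
        | b :: w' => prepend a (stuffle_word v' w)
                     + prepend b (stuffle_v w')
                     + prepend (a + b)%N (stuffle_word v' w')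
        end
  end.

Definition stuffle (u v : word_space) : word_space :=
  \sum_(a <- msupp u) \sum_(b <- msupp v)
    (mcoeff a u * mcoeff b v) *: stuffle_word a b.

Definition stuffle_exp (u : word_space) (l : nat) : word_space :=
  iter l (stuffle u) (word [::]).

Definition in_H0 (u : word_space) : Prop :=
  forall w, w \in msupp u -> admissible w.

Definition is_stuffle_decomp (k : seq nat)
    (u : {ffun 'I_(size k).+1 -> word_space}) : Prop :=
  (forall l, in_H0 (u l)) /\
  word k = \sum_(l < (size k).+1) stuffle (u l) (stuffle_exp (word [:: 1%N]) l).

(* The decomposition exists and is unique for every index; the default value
   0 is only used when k is not an index. *)
Definition stuffle_decomp (k : seq nat) :
    {ffun 'I_(size k).+1 -> word_space} :=
  xget [ffun=> 0] [set u | is_stuffle_decomp u].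

Section Multitangent.
Variable R : realType.
Local Notation C := R[i].
Implicit Types (k : seq nat) (s X T : C).

Definition shifted_monomial k s (n : (size k).-tuple int) : C :=
  \prod_(i < size k) ((tnth n i)%:~R + s) ^- nth 0%N k i.

(* summability.sum is the limit of the finite partial sums along the directed
   set of finite sets of tuples: for complex families this is the sum of an
   absolutely convergent family. *)
Definition multitangent k s : C :=
  summability.sum (fun n : (size k).-tuple int =>
    if sorted <%R n then shifted_monomial s n else 0).

(* For the empty index, the only tuple is empty and the sum is 1. *)
Definition hurwitz_mzv k s : C :=
  summability.sum (fun n : (size k).-tuple int =>
    if path <%R 0 n then shifted_monomial s n else 0).

Definition hurwitz_mzv_lin (u : word_space) s : C :=
  \sum_(a <- msupp u) ratr (mcoeff a u) * hurwitz_mzv a s.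

Definition hurwitz_mzv_reg X k s : C :=
  \sum_(l < (size k).+1) hurwitz_mzv_lin (stuffle_decomp k l) s * X ^+ l.

Definition harmonic_fun s : C :=
  limn (series (fun n : nat => n.+1%:R^-1 - (n.+1%:R + s)^-1)).

(* In the second sum j runs over 0, ..., r - 1 and stands for j + 1. *)
Definition multitangent_reg T k s : C :=
  \sum_(j < (size k).+1)
     (-1) ^+ sumn (take j k)
     * hurwitz_mzv_reg (T - harmonic_fun (- s)) (rev (take j k)) (- s)
     * hurwitz_mzv_reg (T - harmonic_fun s) (drop j k) s
  + \sum_(j < size k)
     (-1) ^+ sumn (take j k) / s ^+ nth 0%N k j
     * hurwitz_mzv_reg (T - harmonic_fun (- s)) (rev (take j k)) (- s)
     * hurwitz_mzv_reg (T - harmonic_fun s) (drop j.+1 k) s.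

End Multitangent.

(* Main.v *)
From HB Require Import structures.
Require Import Defs.
From mathcomp Require Import all_boot all_order all_algebra.
From mathcomp Require Import finmap.
From mathcomp Require Import zify ring lra.
From mathcomp Require Import all_classical all_reals all_analysis.
From mathcomp Require Import complex.
From mathcomp.analysis.showcase Require summability.

Import Order.TTheory GRing.Theory Num.Theory numFieldNormedType.Exports.
Local Open Scope ring_scope.

Set Implicit Arguments.
Unset Strict Implicit.
Unset Printing Implicit Defensive.

(** Cut every series off at height N. The finite sum over
    n_1 < ... < n_r with all |n_i| <= N can be split, with no regularization at all,
    according to how many of the n_i are negative and whether 0 is one of them
    (qsym_two_sided). The positive n_i contribute a truncated Hurwitz multiple
    zeta value of a final segment of k at s; the negative ones, read backwards,
    contribute one of a reversed initial segment at - s, with the sign coming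
    from 1 / (- n + s) = - 1 / (n - s). This is literally the shape of the
    formula that defines the regularized function.

    What makes the limit harmless is that k_1, k_r >= 2: every nonempty
    final segment of k ends with k_r and every nonempty reversed initial segment
    ends with k_1, so only
    admissible indices occur. Two facts then finish the proof.

    - On an admissible index the stuffle regularization changes nothing, whatever
      the value given to the index (1): its only stuffle decomposition is the
      trivial one (stuffle_decomp_admissible). The tool is the linear map that
      removes a final letter 1 from a word and kills all other words. On indices
      it is a derivation for the stuffle product, it kills admissible indices and
      sends (1) to the empty index, so it acts as d/dX on polynomials in
      X = (1) with admissible coefficients. Hence a polynomial that represents
      an admissible index has derivative 0, that is, degree 0.

    - Each truncated sum converges to the corresponding sum over the directed
      set of finite families of tuples. All terms satisfy
      |1 / (n + s)| <= 2 / |n| for n != 0, the truncated sums of the absolute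
      values over an admissible index are bounded by a telescoping estimate
      (qsym_harmonic_le), and absolutely bounded complex families may be summed
      along any exhausting sequence of finite sets (cvg_sum_exhaustion). *)

(** * Linear extension and the stuffle product *)

(** Locked: [prepend] and [stuffle] are instances of the same sum, and unification
    would otherwise unfold and confuse them. *)
HB.lock Definition linext (V : lmodType rat) (f : seq nat -> V) (u : word_space) : V :=
  \sum_(w <- msupp u) mcoeff w u *: f w.

Lemma linextE (V : lmodType rat) (f : seq nat -> V) (u : word_space) :
  linext f u = \sum_(w <- msupp u) mcoeff w u *: f w.
Proof. by rewrite linext.unlock. Qed.

Section LinearExtension.
Variable V : lmodType rat.
Implicit Types (f : seq nat -> V) (u v : word_space) (c : rat).

(** Enlarging the summation set lets two supports be compared on their union,
    which is how linearity is obtained. *)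
Lemma linextEw f u (A : {fset (seq nat)}) :
  (msupp u `<=` A)%fset -> linext f u = \sum_(w <- A) mcoeff w u *: f w.
Proof.
move=> uA; rewrite !linextE (big_fset_incl _ uA) // => w _ wNu.
by rewrite mcoeff_outdom // scale0r.
Qed.

Lemma linext_is_linear f : linear (linext f).
Proof.
move=> c u v; pose A := (msupp u `|` msupp v)%fset.
have uA : (msupp u `<=` A)%fset by exact: fsubsetUl.
have vA : (msupp v `<=` A)%fset by exact: fsubsetUr.
have cuvA : (msupp (c *: u + v) `<=` A)%fset.
  apply: fsubset_trans (msuppD_le _ _) _; rewrite fsubUset vA andbT.
  exact: fsubset_trans (msuppZ_le _ _) uA.
rewrite (linextEw f uA) (linextEw f vA) (linextEw f cuvA) scaler_sumr -big_split /=.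
by apply: eq_bigr => w _; rewrite mcoeffD mcoeffZ scalerDl scalerA.
Qed.

HB.instance Definition _ f :=
  GRing.isLinear.Build rat word_space V _ (linext f) (linext_is_linear f).

Lemma linext_add f u v : linext f (u + v) = linext f u + linext f v.
Proof. exact: linearD. Qed.

Lemma linext_scale f c u : linext f (c *: u) = c *: linext f u.
Proof. exact: linearZ. Qed.

Lemma linext_word f w : linext f (word w) = f w.
Proof. by rewrite !linextE /word msuppU oner_eq0 big_seq_fset1 mcoeffUU scale1r. Qed.

Lemma eq_linext_supp f g u :
  (forall w, w \in msupp u -> f w = g w) -> linext f u = linext g u.
Proof.
by move=> fg; rewrite !linextE !big_seq; apply: eq_bigr => w /fg ->.
Qed.

Lemma eq_linext f g u : f =1 g -> linext f u = linext g u.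
Proof. by move=> fg; apply: eq_linext_supp. Qed.

Lemma linextD f g u : linext (fun w => f w + g w) u = linext f u + linext g u.
Proof.
by rewrite !linextE -big_split; apply: eq_bigr => w _; rewrite scalerDr.
Qed.

Lemma linext0f u : linext (fun=> 0) u = 0 :> V.
Proof. by rewrite linextE big1 // => w _; rewrite scaler0. Qed.

End LinearExtension.

Section StuffleDecomposition.
Implicit Types (u : word_space) (v w k : seq nat).

Lemma linext_id u : linext word u = u.
Proof.
rewrite [RHS]monalgE !linextE; apply: eq_bigr => w _.
by apply/malgP => w'; rewrite mcoeffZ !mcoeffU mulr_natr.
Qed.

Lemma linear_linext (V W : lmodType rat) (g : {linear V -> W}) f u :
  g (linext f u) = linext (g \o f) u.
Proof. by rewrite !linextE linear_sum; apply: eq_bigr => w _; rewrite linearZ. Qed.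

Lemma linext_linext (V : lmodType rat) (f : seq nat -> seq nat -> V) u (v : word_space) :
  linext (fun a => linext (f a) v) u = linext (fun b => linext (f^~ b) u) v.
Proof.
rewrite !linextE; under eq_bigr do rewrite linextE scaler_sumr.
rewrite exchange_big; apply: eq_bigr => b _; rewrite linextE scaler_sumr.
by apply: eq_bigr => a _; rewrite !scalerA mulrC.
Qed.

Lemma prependE a u : prepend a u = linext (fun w => word (a :: w)) u.
Proof. by rewrite linextE. Qed.

Lemma prepend_is_linear a : linear (prepend a).
Proof. by move=> c u v; rewrite !prependE linearP. Qed.

HB.instance Definition _ a :=
  GRing.isLinear.Build rat word_space word_space _ (prepend a)
    (prepend_is_linear a).

Lemma prependD a u (v : word_space) : prepend a (u + v) = prepend a u + prepend a v.
Proof. exact: linearD. Qed.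

Lemma prependZ a c u : prepend a (c *: u) = c *: prepend a u.
Proof. exact: linearZ. Qed.

Lemma prepend_word a w : prepend a (word w) = word (a :: w).
Proof. by rewrite prependE linext_word. Qed.

Lemma linext_prepend (V : lmodType rat) (f : seq nat -> V) a u :
  linext f (prepend a u) = linext (fun w => f (a :: w)) u.
Proof.
by rewrite prependE linear_linext; apply: eq_linext => w /=; rewrite linext_word.
Qed.

Lemma stuffleE u (v : word_space) : stuffle u v = linext (fun a => linext (stuffle_word a) v) u.
Proof.
rewrite /stuffle linextE; apply: eq_bigr => a _; rewrite linextE scaler_sumr.
by apply: eq_bigr => b _; rewrite scalerA.
Qed.

Lemma stuffleEr u (v : word_space) : stuffle u v = linext (fun b => linext (stuffle_word^~ b) u) v.
Proof. by rewrite stuffleE linext_linext. Qed.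

Lemma stuffle_word_nil v : stuffle_word v [::] = word v.
Proof. by case: v. Qed.

Lemma stuffle_word_cons a v b w :
  stuffle_word (a :: v) (b :: w) =
    prepend a (stuffle_word v (b :: w)) + prepend b (stuffle_word (a :: v) w)
    + prepend (a + b) (stuffle_word v w).
Proof. by []. Qed.

Lemma stuffle1l u : stuffle (word [::]) u = u.
Proof. by rewrite stuffleE linext_word linext_id. Qed.

Lemma stuffle1r u : stuffle u (word [::]) = u.
Proof.
rewrite stuffleEr linext_word -[RHS]linext_id; apply: eq_linext => w.
exact: stuffle_word_nil.
Qed.

Lemma stuffle0l u : stuffle 0 u = 0.
Proof. by rewrite stuffleE linear0. Qed.

Lemma stuffleZr c u (v : word_space) : stuffle u (c *: v) = c *: stuffle u v.
Proof. by rewrite !stuffleEr linearZ. Qed.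

(** * Removing a final letter 1 *)

(** Removes the last letter when it is 1, and is 0 on every other word. Recursion
    on the first letter matches the recursion of [stuffle_word]. *)
Fixpoint strip1_word (w : seq nat) : word_space :=
  if w is a :: w' then
    prepend a (strip1_word w') + ((w' == [::]) && (a == 1%N))%:R *: word [::]
  else 0.

Definition strip1 : word_space -> word_space := linext strip1_word.

HB.instance Definition _ :=
  GRing.isLinear.Build rat word_space word_space _ strip1
    (linext_is_linear strip1_word).

(** Adding a first letter commutes with looking at the last one, except on the
    empty word, where the new letter is both. *)
Lemma strip1_prepend a u :
  strip1 (prepend a u) =
    prepend a (strip1 u) + ((a == 1%N)%:R * mcoeff [::] u) *: word [::].
Proof.
rewrite /strip1 linext_prepend /= linextD; congr (_ + _).
  by rewrite linear_linext.
rewrite -[in RHS](linext_id u) !linextE raddf_sum mulr_sumr scaler_suml.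
apply: eq_bigr => w _; rewrite /= mcoeffZ mcoeffU scalerA.
by case: w => [|b w]; case: (a == 1%N); rewrite /= ?mulr1 ?mul1r ?mulr0 ?mul0r.
Qed.

Lemma strip1_prepend_eq0 a u : (a == 1%N)%:R * mcoeff [::] u = 0 ->
  strip1 (prepend a u) = prepend a (strip1 u).
Proof. by move=> au0; rewrite strip1_prepend au0 scale0r addr0. Qed.

Lemma mcoeff_nil_prepend a u : mcoeff [::] (prepend a u) = 0.
Proof.
by rewrite prependE linextE raddf_sum big1 // => w _; rewrite /= mcoeffZ mcoeffU mulr0.
Qed.

Lemma mcoeff_nil_stuffle v w :
  v != [::] -> mcoeff [::] (stuffle_word v w) = 0.
Proof.
case: v => // a v _; case: w => [|b w]; first by rewrite stuffle_word_nil mcoeffU.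
by rewrite stuffle_word_cons !mcoeffD !mcoeff_nil_prepend !addr0.
Qed.

Lemma mcoeff_nil_stuffler v w :
  w != [::] -> mcoeff [::] (stuffle_word v w) = 0.
Proof.
case: w => // b w _; case: v => [|a v]; first by rewrite mcoeffU.
exact: mcoeff_nil_stuffle.
Qed.

Lemma strip1D u (v : word_space) : strip1 (u + v) = strip1 u + strip1 v.
Proof. exact: linearD. Qed.

Lemma is_index_cons a v : is_index (a :: v) = (0 < a)%N && is_index v.
Proof. by []. Qed.

Lemma strip1_word_cons a v :
  strip1_word (a :: v) =
    prepend a (strip1_word v) + ((v == [::]) && (a == 1%N))%:R *: word [::].
Proof. by []. Qed.

Lemma stuffle_prepend a b u w :
  linext (stuffle_word^~ (b :: w)) (prepend a u) =
    prepend a (linext (stuffle_word^~ (b :: w)) u)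
    + prepend b (linext (stuffle_word^~ w) (prepend a u))
    + prepend (a + b) (linext (stuffle_word^~ w) u).
Proof. by rewrite !linext_prepend !linear_linext -!linextD; apply: eq_linext. Qed.

Lemma stuffle_prependr a v b u :
  linext (stuffle_word (a :: v)) (prepend b u) =
    prepend a (linext (stuffle_word v) (prepend b u))
    + prepend b (linext (stuffle_word (a :: v)) u)
    + prepend (a + b) (linext (stuffle_word v) u).
Proof. by rewrite !linext_prepend !linear_linext -!linextD; apply: eq_linext. Qed.

(** The last letter of a term in a stuffle product is the last letter of one of
    the factors, or the sum of both last letters; as letters of indices are
    positive, such a sum is never 1. This gives the Leibniz rule. *)
Lemma strip1_stuffle_word v w : is_index v -> is_index w ->
  strip1 (stuffle_word v w) =
    linext (stuffle_word^~ w) (strip1_word v) + linext (stuffle_word v) (strip1_word w).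
Proof.
elim: v w => [|a v IHv] w.
  by move=> _ _; rewrite /= linear0 add0r [LHS]linext_word linext_id.
rewrite is_index_cons => /andP[a_gt0 v_idx].
elim: w => [_|b w IHw]; last rewrite is_index_cons => /andP[b_gt0 w_idx].
  rewrite linear0 addr0 [LHS]linext_word -[LHS]linext_id.
  by apply: eq_linext => x; rewrite stuffle_word_nil.
have bw_idx : is_index (b :: w) by rewrite is_index_cons b_gt0.
(* The empty word does not occur in the first two products, and the letter a + b
   put before the third one is not 1. *)
rewrite stuffle_word_cons !strip1D strip1_prepend_eq0; last first.
  by rewrite mcoeff_nil_stuffler ?mulr0.
rewrite strip1_prepend_eq0; last by rewrite mcoeff_nil_stuffle ?mulr0.
rewrite strip1_prepend_eq0; last first.
  by case: a b a_gt0 b_gt0 {IHw bw_idx} => [|[|a]] [|b] // *; rewrite mul0r.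
rewrite (IHw w_idx) (IHv _ v_idx bw_idx) (IHv _ v_idx w_idx).
rewrite [strip1_word (b :: w)]strip1_word_cons.
rewrite [X in _ = linext _ X + _]strip1_word_cons.
rewrite !(linext_add, linext_scale) !linext_word !stuffle_word_nil.
rewrite stuffle_prepend stuffle_prependr -!prepend_word !prependD.
rewrite -/strip1_word !prependZ !prepend_word.
by rewrite [LHS](AC (1*2*3*2) ((1*4*7*5)*(2*6*8*3))).
Qed.

Definition supp_index (u : word_space) := forall w, w \in msupp u -> is_index w.

Lemma supp_index_word w : is_index w -> supp_index (word w).
Proof.
by move=> w_idx x; rewrite msuppU oner_eq0 inE => /eqP ->.
Qed.

Lemma supp_indexD u (v : word_space) : supp_index u -> supp_index v -> supp_index (u + v).
Proof.
move=> u_idx v_idx w /(fsubsetP (msuppD_le u v)); rewrite inE.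
by case/orP => [/u_idx|/v_idx].
Qed.

Lemma supp_indexZ c u : supp_index u -> supp_index (c *: u).
Proof. by move=> u_idx w /(fsubsetP (msuppZ_le c u)) /u_idx. Qed.

Lemma supp_index_linext f u :
  (forall w, w \in msupp u -> supp_index (f w)) -> supp_index (linext f u).
Proof.
move=> f_idx; rewrite !linextE big_seq.
elim/big_ind: _ => [w|v v' | w /f_idx]; first by rewrite msupp0.
  exact: supp_indexD.
exact: supp_indexZ.
Qed.

Lemma supp_index_prepend a u : (0 < a)%N -> supp_index u -> supp_index (prepend a u).
Proof.
move=> a_gt0 u_idx; rewrite prependE; apply: supp_index_linext => w /u_idx w_idx.
by apply: supp_index_word; rewrite is_index_cons a_gt0.
Qed.

Lemma supp_index_stuffle_word v w :
  is_index v -> is_index w -> supp_index (stuffle_word v w).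
Proof.
elim: v w => [|a v IHv] w; first by move=> _; exact: supp_index_word.
move=> av_idx; have /andP[a_gt0 v_idx] := av_idx.
elim: w => [_|b w IHw bw_idx]; first exact: supp_index_word.
have /andP[b_gt0 w_idx] := bw_idx.
rewrite stuffle_word_cons; apply: supp_indexD; first apply: supp_indexD.
- by apply: supp_index_prepend => //; exact: IHv.
- by apply: supp_index_prepend => //; exact: IHw.
- by apply: supp_index_prepend; rewrite ?addn_gt0 ?a_gt0 //; exact: IHv.
Qed.

Lemma supp_index_stuffle u (v : word_space) :
  supp_index u -> supp_index v -> supp_index (stuffle u v).
Proof.
move=> u_idx v_idx; rewrite stuffleE.
apply: supp_index_linext => a /u_idx a_idx.
by apply: supp_index_linext => b /v_idx; exact: supp_index_stuffle_word.
Qed.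

Lemma strip1_stuffle u (v : word_space) : supp_index u -> supp_index v ->
  strip1 (stuffle u v) = stuffle (strip1 u) v + stuffle u (strip1 v).
Proof.
move=> u_idx v_idx.
rewrite [in LHS]stuffleE [X in X + _]stuffleEr [X in _ + X]stuffleE.
rewrite /strip1 linear_linext.
transitivity (linext (fun a => linext (fun b => linext (stuffle_word^~ b) (strip1_word a)
    + linext (stuffle_word a) (strip1_word b)) v) u).
  apply: eq_linext_supp => a /u_idx a_idx /=; rewrite linear_linext.
  by apply: eq_linext_supp => b /v_idx b_idx /=; exact: strip1_stuffle_word.
under eq_linext do rewrite linextD.
rewrite linextD; congr (_ + _).
  by rewrite linext_linext; apply: eq_linext => b; rewrite linear_linext.
by apply: eq_linext => a; rewrite linear_linext.
Qed.

Lemma supp_index_exp1 l : supp_index (stuffle_exp (word [:: 1%N]) l).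
Proof.
elim: l => [|l IHl]; first exact: supp_index_word.
by apply: supp_index_stuffle => //; exact: supp_index_word.
Qed.

(** The derivative of X^l is l X^(l - 1), where X is the index (1). *)
Lemma strip1_exp1 l :
  strip1 (stuffle_exp (word [:: 1%N]) l) =
    l%:R *: stuffle_exp (word [:: 1%N]) l.-1.
Proof.
elim: l => [|l IHl]; first by rewrite scale0r /strip1 /= linext_word.
rewrite /= -/(stuffle_exp _ l) strip1_stuffle; last exact: supp_index_exp1.
  rewrite IHl /strip1 linext_word /= linear0 add0r scale1r stuffle1l stuffleZr.
  case: l {IHl} => [|l]; first by rewrite scale0r addr0 scale1r.
  rewrite -[in RHS]natr1 scalerDl scale1r addrC; congr (_ + _).
exact: supp_index_word.
Qed.

Lemma strip1_admissible w : admissible w -> strip1_word w = 0.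
Proof.
rewrite /admissible => /andP[_]; elim: w => // a w IHw.
rewrite strip1_word_cons; case: w IHw => [_ /= a_ge2|b w IHw w_adm].
  rewrite linear0 add0r; case: eqP a_ge2 => [->|_ _] //; exact: scale0r.
by rewrite IHw // linear0 add0r scale0r.
Qed.

Lemma strip1_H0 u : in_H0 u -> strip1 u = 0.
Proof.
move=> u_H0; rewrite -[RHS](linext0f word_space u).
by apply: eq_linext_supp => w /u_H0; exact: strip1_admissible.
Qed.

(** The m-th derivative of u X^l, with u a constant and X the index (1). *)
Lemma iter_strip1_H0 u l m : in_H0 u ->
  iter m strip1 (stuffle u (stuffle_exp (word [:: 1%N]) l)) =
    (l ^_ m)%:R *: stuffle u (stuffle_exp (word [:: 1%N]) (l - m)).
Proof.
move=> u_H0; have u_idx : supp_index u by move=> w /u_H0 /andP[].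
elim: m => [|m IHm]; first by rewrite ffactn0 subn0 scale1r.
rewrite iterS IHm linearZ /= strip1_stuffle //; last exact: supp_index_exp1.
rewrite strip1_H0 // stuffle0l add0r strip1_exp1 stuffleZr scalerA.
by rewrite -natrM ffactnSr subnS.
Qed.

Lemma iter_strip1_sum n (F : 'I_n -> word_space) m :
  iter m strip1 (\sum_(i < n) F i) = \sum_(i < n) iter m strip1 (F i).
Proof. by elim: m => //= m ->; exact: linear_sum. Qed.

(** The index (1) is transcendental over the admissible indices: differentiating l
    times isolates l! u_l once all later coefficients are known to vanish. *)
Lemma stuffle_decomp_uniq k d : admissible k -> is_stuffle_decomp d ->
  d = [ffun l : 'I_(size k).+1 => if l == ord0 then word k else 0].
Proof.
move=> k_adm [d_H0 k_eq].
have d0 (l : 'I_(size k).+1) : (0 < l)%N -> d l = 0.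
  (* Descending induction on l. *)
  have [m] := ubnP (size k - l); elim: m l => // m IHm l lt_lm l_gt0.
  have := congr1 (iter l strip1) k_eq.
  have -> : iter l strip1 (word k) = 0.
    rewrite -(prednK l_gt0) iterSr [strip1 _]linext_word strip1_admissible //.
    by elim: (l.-1) => // n IHn; rewrite iterS IHn; exact: linear0.
  rewrite iter_strip1_sum (bigD1 l) //= iter_strip1_H0 // ffactnn subnn stuffle1r.
  rewrite big1 ?addr0 => [/esym/eqP|j j_neq].
    by rewrite scaler_eq0 pnatr_eq0 -leqn0 leqNgt fact_gt0 => /eqP.
  (* Terms of lower degree are killed by the l-th derivative, those of higher
     degree vanish by induction. *)
  case: (ltngtP j l) => [lt_jl|lt_lj|/val_inj eq_jl].
  - by rewrite iter_strip1_H0 // ffact_small // scale0r.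
  - have lt_jk := ltn_ord j.
    rewrite iter_strip1_H0 // IHm ?stuffle0l ?scaler0 ?(ltn_trans l_gt0) //.
    by move: lt_lm lt_lj lt_jk; case: l {l_gt0 j_neq} => l /=; lia.
  - by rewrite eq_jl eqxx in j_neq.
apply/ffunP => l; rewrite ffunE; case: eqVneq => [->|l_neq0].
  rewrite k_eq big_ord_recl stuffle1r big1 ?addr0 // => j _.
  by rewrite d0 ?stuffle0l.
by apply: d0; rewrite lt0n.
Qed.

Lemma stuffle_decomp_admissible k : admissible k ->
  stuffle_decomp k = [ffun l => if l == ord0 then word k else 0].
Proof.
move=> k_adm; rewrite /stuffle_decomp.
apply: (@stuffle_decomp_uniq k) => //.
apply: (@xgetPex _ _ (fun d => is_stuffle_decomp d)).
exists [ffun l => if l == ord0 then word k else 0]; split.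
  move=> l; rewrite ffunE; case: eqP => _ w; last by rewrite msupp0.
  by rewrite msuppU oner_eq0 inE => /eqP ->.
rewrite big_ord_recl ffunE eqxx stuffle1r big1 ?addr0 // => j _.
by rewrite ffunE stuffle0l.
Qed.

End StuffleDecomposition.

(** * Truncated sums *)

Section QSym.
Variable F : fieldType.
Implicit Types (xs ys : seq F) (k : seq nat) (c x y : F).

(** The monomial quasi-symmetric function of index k in the variables xs: the sum
    over i_1 < ... < i_r of the products of the powers xs_(i_j)^(k_j). *)
Fixpoint qsym xs k : F :=
  match xs, k with
  | _, [::] => 1
  | [::], _ :: _ => 0
  | x :: xs', a :: k' => x ^+ a * qsym xs' k' + qsym xs' k
  end.

Lemma qsym_nilr xs : qsym xs [::] = 1.
Proof. by case: xs. Qed.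

Lemma qsym_cons x xs a k :
  qsym (x :: xs) (a :: k) = x ^+ a * qsym xs k + qsym xs (a :: k).
Proof. by []. Qed.

(** Sorts the selected positions by how many of them fall into xs. *)
Lemma qsym_cat xs ys k :
  qsym (xs ++ ys) k =
    \sum_(j < (size k).+1) qsym xs (take j k) * qsym ys (drop j k).
Proof.
elim: xs k => [|x xs IHxs] k.
  rewrite big_ord_recl take0 drop0 mul1r big1 ?addr0 // => j _.
  by case: k j => [|a k] j; [case: j | rewrite mul0r].
case: k => [|a k]; first by rewrite big_ord1 take0 drop0 !qsym_nilr mulr1.
rewrite cat_cons qsym_cons !IHxs [X in _ + X = _]big_ord_recl [in RHS]big_ord_recl.
rewrite take0 !drop0 !qsym_nilr addrCA; congr (_ + _).
rewrite mulr_sumr -big_split; apply: eq_bigr => j _ /=.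
by rewrite mulrDl mulrA.
Qed.

Lemma qsym_rcons xs x k a :
  qsym (rcons xs x) (rcons k a) = qsym xs k * x ^+ a + qsym xs (rcons k a).
Proof.
elim: xs k => [|y xs IHxs] [|b k] /=.
- by rewrite mul1r mulr1.
- by case: k => [|? ?] /=; rewrite mulr0 mul0r.
- by rewrite (IHxs [::]) /= !qsym_nilr addrCA.
- by rewrite IHxs (IHxs (b :: k)) /= mulrDr mulrDl !mulrA addrACA.
Qed.

Lemma qsym_rev xs k : qsym (rev xs) (rev k) = qsym xs k.
Proof.
elim: xs k => [|x xs IHxs] [|a k]; rewrite ?qsym_nilr //.
  by rewrite rev_cons; case: (rev k).
by rewrite !rev_cons qsym_rcons IHxs -rev_cons IHxs mulrC.
Qed.

Lemma qsym_scale c xs k :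
  qsym (map ( *%R c) xs) k = c ^+ sumn k * qsym xs k.
Proof.
elim: xs k => [|x xs IHxs] [|a k] /=; rewrite ?mul1r ?mulr0 //.
by rewrite !IHxs /= exprMn exprD mulrDr !mulrA (mulrAC (c ^+ a)).
Qed.

(** The variable y is selected either not at all (first sum) or with the exponent
    k_j that follows the part of k taken by the left block (second sum). The left
    block is listed outwards from y, hence the reversals. *)
Lemma qsym_two_sided xs y ys k :
  qsym (rev xs ++ y :: ys) k =
    \sum_(j < (size k).+1) qsym xs (rev (take j k)) * qsym ys (drop j k)
    + \sum_(j < size k)
        y ^+ nth 0%N k j * qsym xs (rev (take j k)) * qsym ys (drop j.+1 k).
Proof.
rewrite qsym_cat [in RHS]big_ord_recr big_ord_recr /= drop_size !qsym_nilr.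
rewrite addrAC -big_split -{1}(revK (take _ k)) qsym_rev; congr (_ + _).
apply: eq_bigr => j _ /=; rewrite (drop_nth 0%N (ltn_ord j)).
by rewrite -{1}(revK (take j k)) qsym_rev addrC mulrDr mulrCA mulrA.
Qed.

End QSym.

(** * Sums over subsequences *)

Section Subsequences.
Variable T : eqType.
Implicit Types (xs t : seq T) (x : T).

Fixpoint subseqs n xs : seq (seq T) :=
  match xs, n with
  | _, 0 => [:: [::]]
  | [::], _.+1 => [::]
  | x :: xs', n'.+1 => map (cons x) (subseqs n' xs') ++ subseqs n xs'
  end.

Lemma mem_subseqs n xs t : (t \in subseqs n xs) = (size t == n) && subseq t xs.
Proof.
elim: xs n t => [|x xs IHxs] [|n] t.
- by rewrite inE; case: t.
- by case: t => [|y t] /=; rewrite in_nil ?andbF.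
- by rewrite inE; case: t => //=; rewrite sub0seq.
rewrite mem_cat IHxs; case: t => [|y t] /=.
  by rewrite orbF; apply/mapP => -[].
rewrite eqSS; have [->|y_neq] := eqVneq y x.
  rewrite mem_map ?IHxs; last by move=> u v [].
  by case: eqP => //= _; apply/orb_idr/(subseq_trans (subseq_cons _ _)).
by case: mapP => // -[u _ [y_eq]]; rewrite y_eq eqxx in y_neq.
Qed.

Lemma subseqs_uniq n xs : uniq xs -> uniq (subseqs n xs).
Proof.
elim: xs n => [|x xs IHxs] [|n] //= /andP[xNxs xs_uniq].
rewrite cat_uniq map_inj_uniq ?IHxs //; last by move=> u v [].
rewrite /= andbT; apply/hasPn => t; rewrite mem_subseqs => /andP[_ sub_t].
apply/mapP => -[u _ t_eq]; case/negP: xNxs.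
by apply: (mem_subseq sub_t); rewrite t_eq mem_head.
Qed.

Lemma qsym_subseqs (F : fieldType) (g : T -> F) x0 xs k :
  qsym (map g xs) k =
    \sum_(t <- subseqs (size k) xs) \prod_(i < size k) g (nth x0 t i) ^+ nth 0%N k i.
Proof.
elim: xs k => [|x xs IHxs] [|a k]; rewrite ?big_seq1 ?big_ord0 ?big_nil //.
rewrite [LHS]/= [subseqs _ _]/= big_cat big_map /= -(IHxs (a :: k)); congr (_ + _).
rewrite IHxs mulr_sumr; apply: eq_bigr => t _.
by rewrite [RHS]big_ord_recl.
Qed.

End Subsequences.

(** * Uniform bounds for admissible indices *)

Section Bounds.
Variable F : numFieldType.
Implicit Types (xs ys : seq F) (k : seq nat) (c x y : F).

Lemma ler_qsym (T : eqType) (f g : T -> F) (ns : seq T) k :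
  {in ns, forall n, 0 <= f n <= g n} ->
  0 <= qsym (map f ns) k <= qsym (map g ns) k.
Proof.
elim: ns k => [|n ns IHns] [|a k] fg //=; rewrite ?ler01 ?lexx //.
have /andP[f_ge0 fg_n] := fg n (mem_head _ _).
have fg' : {in ns, forall n, 0 <= f n <= g n}.
  by move=> i i_ns; apply: fg; rewrite inE i_ns orbT.
have /andP[f1 g1] := IHns k fg'; have /andP[f2 g2] := IHns (a :: k) fg'.
rewrite addr_ge0 ?mulr_ge0 ?exprn_ge0 //=.
by rewrite lerD // ler_pM ?exprn_ge0 // lerXn2r ?nnegrE // (le_trans f_ge0).
Qed.

(** The bound 2 / (m + 1) on the tail beyond m reproduces itself: with z = m + 1 and
    the bound 2 / (z + 1) for the tail beyond z, choosing z as the first summation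
    index contributes at most (1 / z) (2 / (z + 1)), omitting it at most 2 / (z + 1),
    and these add up to 2 / z exactly. When a single letter a >= 2 is left, the first
    contribution is at most 1 / z^2 instead. Allowing an arbitrary starting point is
    what makes the induction on n possible. *)
Lemma qsym_harmonic_le m n k : admissible k -> k != [::] ->
  qsym [seq i%:R^-1 | i <- iota m.+1 n] k <= 2 / m.+1%:R :> F.
Proof.
elim: n m k => [|n IHn] m [//|a k]; first by rewrite divr_ge0.
move=> ak_adm _; rewrite [iota _ _]/= map_cons qsym_cons.
have m1_gt0 : 0 < m.+1%:R :> F by rewrite ltr0n.
have a_gt0 : (0 < a)%N by have /andP[/andP[]] := ak_adm.
have q_ak := IHn m.+1 _ ak_adm isT.
have m_le : (m.+1%:R^-1 ^+ a : F) <= m.+1%:R^-1.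
  rewrite -[leRHS]expr1.
  by apply: ler_wiXn2l; rewrite ?invr_ge0 ?invf_le1 ?ler1n.
have [k_nil|k_neq] := eqVneq k [::].
  move: ak_adm q_ak; rewrite k_nil qsym_nilr mulr1 => /andP[_ a_ge2] q_ak.
  have m_le2 : (m.+1%:R^-1 ^+ a : F) <= m.+1%:R^-1 ^+ 2.
    by apply: ler_wiXn2l; rewrite ?invr_ge0 ?invf_le1 ?ler1n.
  apply: le_trans (lerD m_le2 q_ak) _.
  have z_ge1 : 1 <= m.+1%:R :> F by rewrite ler1n.
  rewrite -[X in _ + _ / X]natr1; move: (m.+1%:R : F) m1_gt0 z_ge1 => z z_gt0 z_ge1.
  have z1_gt0 : 0 < z + 1 by rewrite addr_gt0.
  rewrite -subr_ge0.
  have -> : 2 / z - (z^-1 ^+ 2 + 2 / (z + 1)) = (z - 1) / (z ^+ 2 * (z + 1)).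
    by field; rewrite !gt_eqF.
  by rewrite divr_ge0 ?subr_ge0 // mulr_ge0 ?exprn_ge0 // ltW.
have k_adm : admissible k.
  move: ak_adm; rewrite /admissible => /andP[/andP[_ k_idx]].
  by rewrite [is_index k]k_idx; case: (k) k_neq.
have q_k := IHn m.+1 _ k_adm k_neq.
have inv_ge0 i : 0 <= (i%:R^-1 : F) <= i%:R^-1 by rewrite invr_ge0 ler0n lexx.
have q_k0 : 0 <= qsym [seq i%:R^-1 | i <- iota m.+2 n] k :> F.
  by have /andP[] := @ler_qsym _ (fun i => i%:R^-1) (fun i => i%:R^-1)
       (iota m.+2 n) k (fun i _ => inv_ge0 i).
apply: le_trans (lerD (ler_pM _ q_k0 m_le q_k) q_ak) _.
  by rewrite exprn_ge0 // invr_ge0.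
rewrite -(natr1 m.+1); move: (m.+1%:R : F) m1_gt0 => z z_gt0.
have z1_gt0 : 0 < z + 1 by rewrite addr_gt0.
rewrite le_eqVlt; apply/orP; left; apply/eqP; field.
by rewrite !gt_eqF.
Qed.

(** The summand 1 only serves the empty index, for which the sum is 1. *)
Lemma qsym_bounded c (f : nat -> F) k : 0 <= c ->
  (forall n, 0 <= f n.+1 <= c / n.+1%:R) -> admissible k ->
  forall n, qsym [seq f i | i <- iota 1 n] k <= c ^+ sumn k * 2 + 1.
Proof.
move=> c_ge0 f_le k_adm n; have [->|k_neq] := eqVneq k [::].
  by rewrite qsym_nilr lerDr mulr_ge0 ?exprn_ge0.
have := @ler_qsym _ f (fun i => c / i%:R) (iota 1 n) k.
case/(_ _)/andP => [i|_ q_le].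
  by rewrite mem_iota; case: i => // i _; exact: f_le.
apply: le_trans q_le _; rewrite ler_wpDr //.
rewrite (map_comp ( *%R c) (fun i => i%:R^-1)) qsym_scale ler_wpM2l ?exprn_ge0 //.
by have := qsym_harmonic_le 0 n k_adm k_neq; rewrite divr1.
Qed.

End Bounds.

(** * Absolutely bounded complex families *)

Section Summability.
Variables (R : realType) (I : choiceType).
Local Open Scope classical_set_scope.
Implicit Types (A J : {fset I}).

Lemma partial_sumE (V : zmodType) (x : I -> V) J :
  summability.partial_sum x J = \sum_(i <- J) x i.
Proof. by rewrite big_seq_fsetE. Qed.

#[local] Existing Instance summability.totally_filter.

Lemma totally_above J : \forall A \near summability.totally, (J `<=` A)%fset.
Proof. by exists J. Qed.

(** The partial sums of a nonnegative family increase along the directed set of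
    finite sets, so they tend to their supremum. *)
Lemma cvg_sum_ge0 (a : I -> R) (M : R) :
  (forall i, 0 <= a i) -> (forall J, \sum_(i <- J) a i <= M) ->
  exists l : R, summability.partial_sum a @ summability.totally --> l.
Proof.
move=> a_ge0 a_le; pose S := range (summability.partial_sum a).
have S_sup : has_sup S.
  split; first by exists (summability.partial_sum a fset0), fset0.
  by exists M => _ [J _ <-]; rewrite partial_sumE.
exists (sup S); apply/cvgrPdist_lt => e e_gt0.
have [_ [J _ <-] lt_J] := sup_adherent e_gt0 S_sup.
near=> A.
have JA : (J `<=` A)%fset by near: A; exact: totally_above.
have le_JA : summability.partial_sum a J <= summability.partial_sum a A.
  rewrite !partial_sumE.
  rewrite (big_fsetID _ (mem J) A) /=.
  have -> : [fset i in A | i \in J]%fset = J.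
    apply/fsetP => i; rewrite !inE /=; apply/andb_idl; exact: (fsubsetP JA).
  by rewrite lerDl sumr_ge0.
have le_A : summability.partial_sum a A <= sup S.
  by apply: (sup_upper_bound S_sup); exists A.
rewrite ger0_norm ?subr_ge0 // ltrBlDr -ltrBlDl.
exact: lt_le_trans lt_J le_JA.
Unshelve. all: by end_near. Qed.

(** Applied below to the real and imaginary parts of z; y is split into its positive
    and negative parts. *)
Lemma cvg_sum_real (z : I -> R[i]) (y : I -> R) (M : R[i]) :
  (forall i, (`|y i|)%:C%C <= `|z i|) ->
  (forall J, \sum_(i <- J) `|z i| <= M) ->
  exists l : R, summability.partial_sum y @ summability.totally --> l.
Proof.
move=> yz zM.
have bound (a : I -> R) : (forall i, a i <= `|y i|) ->
    forall J, \sum_(i <- J) a i <= complex.Re M.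
  move=> ay J; have : (\sum_(i <- J) a i)%:C%C <= M.
    apply: le_trans (zM J); rewrite rmorph_sum; apply: ler_sum => i _.
    by apply: le_trans (yz i); rewrite lecR.
  by rewrite lecE => /andP[].
have [||l1 l1P] := @cvg_sum_ge0 (fun i => Num.max (y i) 0) (complex.Re M).
- by move=> i; rewrite le_max lexx orbT.
- by apply: bound => i; rewrite ge_max ler_norm normr_ge0.
have [||l2 l2P] := @cvg_sum_ge0 (fun i => Num.max (- y i) 0) (complex.Re M).
- by move=> i; rewrite le_max lexx orbT.
- by apply: bound => i; rewrite ge_max -normrN ler_norm normr_ge0.
exists (l1 - l2).
rewrite (_ : summability.partial_sum y = fun J =>
   summability.partial_sum (fun i => Num.max (y i) 0) J
   - summability.partial_sum (fun i => Num.max (- y i) 0) J).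
  exact: cvgB.
apply/funext => J; rewrite !partial_sumE -sumrB; apply: eq_bigr => i _.
case: (leP (y i) 0) => y_i; first by rewrite max_l ?oppr_ge0 // sub0r opprK.
by rewrite max_r ?subr0 // oppr_le0 ltW.
Qed.

Lemma cvg_real_complex (T : Type) (F : set_system T) {FF : Filter F}
    (f : T -> R) (l : R) :
  f @ F --> l -> (fun t => (f t)%:C%C) @ F --> (l%:C%C : R[i]).
Proof.
move=> /cvgrPdist_lt fl; apply/cvgrPdist_lt => e e_gt0.
have eE : e = (complex.Re e)%:C%C by rewrite RRe_real // gtr0_real.
have : 0 < complex.Re e by rewrite -ltcR -eE.
move=> /fl; apply: filterS => t.
rewrite -rmorphB normc_def /= expr0n addr0 sqrtr_sqr eE ltcR.
by [].
Qed.

(** The imaginary part is reached through Re (z i) = - Im z. *)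
Lemma cvg_sum_complex (z : I -> R[i]) (M : R[i]) :
  (forall J, \sum_(i <- J) `|z i| <= M) ->
  summability.partial_sum z @ summability.totally --> summability.sum z.
Proof.
move=> zM.
have [|l1 l1P] := @cvg_sum_real z (fun i => complex.Re (z i)) M _ zM.
  by move=> i; exact: normc_ge_Re.
have [|l2 l2P] := @cvg_sum_real z (fun i => complex.Re (z i * 'i%C)) M _ zM.
  move=> i; apply: le_trans (normc_ge_Re _) _.
  by rewrite normrM (normc_def 'i%C) /= expr0n expr1n add0r sqrtr1 mulr1.
have := cvgB (cvg_real_complex l1P)
             (cvgMl_tmp (a := 'i%C) (cvg_real_complex l2P)).
set f := (f in f @ _ --> _) => cvg_f.
have fE : f = summability.partial_sum z.
  apply/funext => J; rewrite /f !fctE /= !partial_sumE !rmorph_sum mulr_sumr -sumrB.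
  by apply: eq_bigr => i _; rewrite ReiNIm rmorphN mulrN opprK -complexE.
by apply: (cvgP (l1%:C%C - 'i%C * l2%:C%C)); rewrite -fE; exact: cvg_f.
Qed.

(** Eventually containing every finite set is exactly convergence of J to the filter
    along which the family is summed. *)
Lemma cvg_sum_exhaustion (z : I -> R[i]) (M : R[i]) (J : nat -> {fset I}) :
  (forall A, \forall N \near \oo, (A `<=` J N)%fset) ->
  (forall N, \sum_(i <- J N) `|z i| <= M) ->
  \sum_(i <- J N) z i @[N --> \oo] --> summability.sum z.
Proof.
move=> J_exh zM.
have zM' A : \sum_(i <- A) `|z i| <= M.
  have [N _ /(_ N (leqnn N)) /= AJ] := J_exh A.
  apply: le_trans (zM N); rewrite (big_fsetID _ (mem A) (J N)) /=.
  have -> : [fset i in J N | i \in A]%fset = A.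
    by apply/fsetP => i; rewrite !inE /=; apply/andb_idl; exact: (fsubsetP AJ).
  by rewrite lerDl sumr_ge0.
have -> : (fun N => \sum_(i <- J N) z i) = summability.partial_sum z \o J.
  by apply/funext => N /=; rewrite partial_sumE.
apply: cvg_comp (cvg_sum_complex zM').
move=> /= P [A _ AP]; have := J_exh A; apply: filterS => N AJ; exact: AP.
Qed.

End Summability.

(** * Boxes of integer tuples *)

Section Boxes.
Local Open Scope classical_set_scope.
Implicit Types (t xs : seq int).

Definition box r N : {fset r.-tuple int} :=
  [fset map_tuple (fun i : 'I_(N.*2.+1) => i%:Z - N%:Z) t
  | t in {: r.-tuple 'I_(N.*2.+1)}]%fset.

Lemma mem_box r N (t : r.-tuple int) :
  (t \in box r N) = all (fun n => `|n| <= N)%N t.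
Proof.
apply/imfsetP/allP => [[u _ -> n /mapP[i _ ->]]|t_le].
  by have := ltn_ord i; lia.
exists [tuple of map (fun n => inord (absz (n + N%:Z))) t] => //.
apply: val_inj => /=; rewrite -map_comp -[LHS]map_id.
apply/eq_in_map => n /t_le n_le /=; rewrite inordK; lia.
Qed.

Lemma box_exhaustive r (A : {fset r.-tuple int}) :
  \forall N \near \oo, (A `<=` box r N)%fset.
Proof.
exists (\max_(t : A) \max_(n <- val t) `|n|%N)%N => // N /= le_N.
apply/fsubsetP => t tA; rewrite mem_box; apply/allP => n nt.
apply: leq_trans le_N; apply: leq_trans (leq_bigmax [` tA]%fset) => /=.
exact: (leq_bigmax_seq (P := fun=> true) (F := fun n : int => absz n) n nt).
Qed.

Lemma sorted_subseq t xs : sorted <%R xs ->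
  subseq t xs = sorted <%R t && all (mem xs) t.
Proof.
move=> xs_sorted; apply/idP/andP => [sub_t|[t_sorted /allP t_xs]].
  rewrite (subseq_sorted lt_trans sub_t) //; split=> //.
  by apply/allP => n; exact: (mem_subseq sub_t).
suff -> : t = seq.filter (mem t) xs by exact: filter_subseq.
apply: (irr_sorted_eq (leT := <%R)) => //; first exact: lt_trans.
  exact: (sorted_filter lt_trans).
by move=> n; rewrite mem_filter /=; apply/esym/andb_idr => /t_xs.
Qed.

(** Within the box of size N, the tuples selected by P are the strictly increasing
    tuples with entries in xs. Taking P to be increase, or increase from 0, covers
    the multitangent function and the Hurwitz multiple zeta values. *)
Lemma qsym_box (F : fieldType) (h : int -> F) (P : pred (seq int)) xs k N :
  sorted <%R xs ->
  (forall t, all (fun n => `|n| <= N)%N t && P t = sorted <%R t && all (mem xs) t) ->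
  \sum_(t <- box (size k) N)
    (if P t then \prod_(i < size k) h (tnth t i) ^+ nth 0%N k i else 0)
  = qsym (map h xs) k.
Proof.
move=> xs_sorted PE; rewrite (qsym_subseqs h 0) -big_mkcond -big_filter /=.
under eq_bigr do under eq_bigr do rewrite (tnth_nth 0).
rewrite -(big_map val predT
  (fun t => \prod_(i < size k) h (nth 0 t i) ^+ nth 0%N k i)).
apply: perm_big; apply: uniq_perm.
- by rewrite (map_inj_uniq val_inj) filter_uniq ?fset_uniq.
- by apply/subseqs_uniq/(sorted_uniq lt_trans) => // n; rewrite ltxx.
move=> t; rewrite mem_subseqs sorted_subseq // -PE.
apply/mapP/andP => [[u]|[t_size /andP[t_box tP]]].
  by rewrite mem_filter => /andP[uP]; rewrite mem_box => u_box -> ; rewrite size_tuple u_box.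
by exists (Tuple t_size); rewrite // mem_filter mem_box tP.
Qed.

Definition positives N : seq int := map Posz (iota 1 N).

Definition two_sided N : seq int :=
  rev (map -%R (positives N)) ++ 0 :: positives N.

Lemma mem_positives N n : (n \in positives N) = (0 < n) && (`|n| <= N)%N.
Proof.
apply/mapP/andP => [[j j_iota ->]|[n_gt0 n_le]]; first by move: j_iota; rewrite mem_iota; lia.
by exists `|n|%N; [rewrite mem_iota; lia | lia].
Qed.

Lemma mem_two_sided N n : (n \in two_sided N) = (`|n| <= N)%N.
Proof.
rewrite mem_cat mem_rev inE mem_positives -[n \in map _ _](mem_map oppr_inj).
rewrite -map_comp (eq_map (g := id)); last by move=> i /=; rewrite opprK.
by rewrite map_id mem_positives; lia.
Qed.

Lemma path_positives N : path <%R 0 (positives N).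
Proof.
rewrite path_sortedE; last exact: lt_trans.
apply/andP; split; first by apply/allP => n; rewrite mem_positives => /andP[].
rewrite sorted_map (eq_sorted (e' := ltn)); first exact: iota_ltn_sorted.
by move=> i j.
Qed.

Lemma sorted_two_sided N : sorted <%R (two_sided N).
Proof.
have /path_sorted pos_sorted := path_positives N.
have neg_sorted : sorted <%R (rev (map -%R (positives N))).
  rewrite rev_sorted sorted_map; apply: sub_sorted pos_sorted => i j /=.
  by rewrite ltrN2.
rewrite /two_sided; move: neg_sorted; set neg := rev _ => neg_sorted.
have neg_lt0 : {in neg, forall n, n < 0}.
  move=> n; rewrite mem_rev => /mapP[m]; rewrite mem_positives => /andP[m_gt0 _ ->].
  by rewrite oppr_lt0.
case: neg neg_sorted neg_lt0 => [|n neg] /= neg_sorted neg_lt0.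
  exact: path_positives.
by rewrite cat_path neg_sorted /= path_positives andbT neg_lt0 ?mem_last.
Qed.

End Boxes.

(** * Passing to the limit *)

Section Limits.
Variable R : realType.
Local Notation C := R[i].
Local Open Scope classical_set_scope.
Implicit Types (s : C) (k : seq nat).

Definition shift_inv s (n : int) : C := (n%:~R + s)^-1.

(** The real part of n + 1 + s exceeds n + 1/2, which is at least (n + 1) / 2. *)
Lemma norm_shift_inv_le s n : `|complex.Re s| < 2^-1 ->
  0 <= `|shift_inv s n.+1| <= 2 / n.+1%:R.
Proof.
move=> s_lt; rewrite normr_ge0 normfV /=.
have n_gt0 : 0 < n.+1%:R / 2 :> C by rewrite divr_gt0 // ltr0n.
have n_le : n.+1%:R / 2 <= `|(n.+1)%:~R + s|.
  apply: le_trans (normc_ge_Re _).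
  have -> : n.+1%:R / 2 = (n.+1%:R / 2)%:C%C :> C.
    by rewrite rmorphM fmorphV !rmorph_nat.
  rewrite lecR raddfD /=.
  have -> : complex.Re (n.+1%:~R : C) = n.+1%:R.
    by rewrite -[_%:~R]/(n.+1%:R) -(rmorph_nat (real_complex R)).
  have n_ge1 : 1 <= n.+1%:R :> R by rewrite ler1n.
  rewrite ler_normr; apply/orP; left.
  by move: s_lt; rewrite ltr_norml => /andP[]; lra.
by rewrite -[leRHS]invf_div lef_pV2 // posrE // (lt_le_trans n_gt0).
Qed.

Lemma cvg_qsym s k (P : pred (seq int)) (xs : nat -> seq int) (M : C) :
  (forall N, sorted <%R (xs N)) ->
  (forall N t, all (fun n => `|n| <= N)%N t && P t =
     sorted <%R t && all (mem (xs N)) t) ->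
  (forall N, qsym [seq `|shift_inv s n| | n <- xs N] k <= M) ->
  qsym [seq shift_inv s n | n <- xs N] k @[N --> \oo] -->
  summability.sum (fun n : (size k).-tuple int =>
    if P n then shifted_monomial s n else 0).
Proof.
move=> xs_sorted PE xs_le.
set z := (z in summability.sum z).
have -> : (fun N => qsym [seq shift_inv s n | n <- xs N] k) =
    fun N => \sum_(t <- box (size k) N) z t.
  apply/funext => N; rewrite -(qsym_box _ k (xs_sorted N) (PE N)).
  apply: eq_bigr => t _; rewrite /z /shifted_monomial.
  by case: ifP => // _; apply: eq_bigr => i _; rewrite exprVn.
apply: (cvg_sum_exhaustion (M := M)); first exact: box_exhaustive.
move=> N; rewrite (le_trans _ (xs_le N)) //.
rewrite -(qsym_box _ k (xs_sorted N) (PE N)) le_eqVlt; apply/orP; left; apply/eqP.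
apply: eq_bigr => t _; rewrite /z /shifted_monomial.
case: ifP => _; last exact: normr0.
by rewrite normr_prod; apply: eq_bigr => i _; rewrite -exprVn normrX.
Qed.

Lemma qsym_positives_bounded s k N : `|complex.Re s| < 2^-1 -> admissible k ->
  qsym [seq `|shift_inv s n| | n <- positives N] k <= 2 ^+ sumn k * 2 + 1.
Proof.
move=> s_lt k_adm; rewrite -map_comp.
apply: (@qsym_bounded _ 2 (fun n : nat => `|shift_inv s n|)) => // n.
exact: norm_shift_inv_le.
Qed.

Lemma qsym_norm_ge0 s xs k : 0 <= qsym [seq `|shift_inv s n| | n <- xs] k.
Proof.
have := @ler_qsym _ _ (fun n => `|shift_inv s n|) (fun n => `|shift_inv s n|) xs k.
by case/(_ _)/andP => // n _; rewrite normr_ge0 lexx.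
Qed.

Lemma cvg_hurwitz_mzv s k : `|complex.Re s| < 2^-1 -> admissible k ->
  qsym [seq shift_inv s n | n <- positives N] k @[N --> \oo] --> hurwitz_mzv k s.
Proof.
move=> s_lt k_adm.
apply: (cvg_qsym (P := path <%R 0) _ _ (fun N => qsym_positives_bounded N s_lt k_adm)).
  by move=> N; exact: path_sorted (path_positives N).
move=> N t; rewrite path_sortedE; last exact: lt_trans.
rewrite andbA andbC -all_predI; congr (_ && _); apply: eq_all => n /=.
by rewrite mem_positives andbC.
Qed.

Lemma shift_invN s n : shift_inv s (- n) = - shift_inv (- s) n.
Proof. by rewrite /shift_inv -[RHS]invrN opprD opprK -rmorphN. Qed.

Lemma admissible_drop k j : is_index k -> (2 <= last 0 k)%N ->
  admissible (drop j k).
Proof.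
rewrite /admissible /is_index => k_idx; rewrite -{1 2}(cat_take_drop j k) in k_idx *.
rewrite last_cat; move: k_idx; rewrite all_cat => /andP[_ ->].
by case: (drop j k) => //= *; apply/orP; right.
Qed.

Lemma admissible_rev_take k j : is_index k -> (2 <= head 0 k)%N ->
  admissible (rev (take j k)).
Proof.
rewrite /admissible /is_index all_rev; case: k => //= a k k_idx a_ge2.
case: j => //= j; rewrite rev_cons last_rcons a_ge2 orbT andbT.
case/andP: k_idx => -> k_idx /=.
by move: k_idx; rewrite -{1}(cat_take_drop j k) all_cat => /andP[].
Qed.

Lemma qsym_two_sided_positives (F : fieldType) (h : int -> F) k N :
  qsym (map h (two_sided N)) k =
    \sum_(j < (size k).+1)
      qsym [seq h (- n) | n <- positives N] (rev (take j k))
      * qsym (map h (positives N)) (drop j k)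
    + \sum_(j < size k)
        h 0 ^+ nth 0%N k j
        * qsym [seq h (- n) | n <- positives N] (rev (take j k))
        * qsym (map h (positives N)) (drop j.+1 k).
Proof.
by rewrite map_cat map_rev map_cons -map_comp qsym_two_sided.
Qed.

(** Splitting at 0 reduces the bound to the one-sided sums, all of which belong to
    admissible indices. *)
Lemma qsym_two_sided_bounded s k : `|complex.Re s| < 2^-1 ->
  is_index k -> (2 <= head 0 k)%N -> (2 <= last 0 k)%N ->
  exists M : C, forall N, qsym [seq `|shift_inv s n| | n <- two_sided N] k <= M.
Proof.
move=> s_lt k_idx k_first k_last.
have sN_lt : `|complex.Re (- s)| < 2^-1 by rewrite raddfN normrN.
pose B w : C := 2 ^+ sumn w * 2 + 1.
exists (\sum_(j < (size k).+1) B (rev (take j k)) * B (drop j k)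
  + \sum_(j < size k) `|shift_inv s 0| ^+ nth 0%N k j
      * B (rev (take j k)) * B (drop j.+1 k)) => N.
have shiftN : (fun n : int => `|shift_inv s (- n)|) =1 fun n => `|shift_inv (- s) n|.
  by move=> n; rewrite shift_invN normrN.
rewrite qsym_two_sided_positives (eq_map shiftN).
apply: lerD; apply: ler_sum => j _.
  by apply: ler_pM; rewrite ?qsym_norm_ge0 ?qsym_positives_bounded
    ?admissible_drop ?admissible_rev_take.
apply: ler_pM; rewrite ?mulr_ge0 ?exprn_ge0 ?qsym_norm_ge0 //.
  by rewrite ler_wpM2l ?exprn_ge0 ?qsym_positives_bounded ?admissible_rev_take.
by rewrite qsym_positives_bounded ?admissible_drop.
Qed.

Lemma cvg_multitangent s k : `|complex.Re s| < 2^-1 ->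
  is_index k -> (2 <= head 0 k)%N -> (2 <= last 0 k)%N ->
  qsym [seq shift_inv s n | n <- two_sided N] k @[N --> \oo] --> multitangent k s.
Proof.
move=> s_lt k_idx k_first k_last.
have [M le_M] := qsym_two_sided_bounded s_lt k_idx k_first k_last.
apply: (cvg_qsym (P := sorted <%R) _ _ le_M); first exact: sorted_two_sided.
move=> N t; rewrite andbC; congr (_ && _); apply: eq_all => n /=.
by rewrite mem_two_sided.
Qed.

(** Only the constant term of the polynomial in X is present. *)
Lemma hurwitz_mzv_reg_admissible X k s : admissible k ->
  hurwitz_mzv_reg X k s = hurwitz_mzv k s.
Proof.
move=> k_adm; rewrite /hurwitz_mzv_reg stuffle_decomp_admissible //.
have lin0 : hurwitz_mzv_lin 0 s = 0 :> C.
  by rewrite /hurwitz_mzv_lin msupp0 big_seq_fset0.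
rewrite big_ord_recl ffunE eqxx mulr1 big1 ?addr0 => [|j _]; last first.
  by rewrite ffunE lin0 mul0r.
rewrite /hurwitz_mzv_lin msuppU oner_eq0 big_seq_fset1 mcoeffUU.
by rewrite rmorph1 mul1r.
Qed.

Lemma cvg_bigsum (n : nat) (f : 'I_n -> nat -> C) (l : 'I_n -> C) :
  (forall j, f j N @[N --> \oo] --> l j) ->
  \sum_(j < n) f j N @[N --> \oo] --> \sum_(j < n) l j.
Proof.
move=> fl; apply: cvg_big => //; exact: add_continuous.
Qed.

(** The truncated sum has two limits: the multitangent series, and, after splitting it
    at 0, the regularized expression. *)
Lemma multitangent_reg_eq T s k : `|complex.Re s| < 2^-1 ->
  is_index k -> (2 <= head 0 k)%N -> (2 <= last 0 k)%N ->
  multitangent_reg T k s = multitangent k s.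
Proof.
move=> s_lt k_idx k_first k_last.
have sN_lt : `|complex.Re (- s)| < 2^-1 by rewrite raddfN normrN.
have neg_cvg j : qsym [seq shift_inv s (- n) | n <- positives N] (rev (take j k))
    @[N --> \oo] --> (-1) ^+ sumn (take j k) * hurwitz_mzv (rev (take j k)) (- s).
  have -> : (fun N => qsym [seq shift_inv s (- n) | n <- positives N] (rev (take j k)))
    = fun N => (-1) ^+ sumn (take j k)
        * qsym [seq shift_inv (- s) n | n <- positives N] (rev (take j k)).
    apply/funext => N; rewrite -(sumn_rev (take j k)) -qsym_scale -(map_comp ( *%R (-1))).
    by congr qsym; apply: eq_map => n /=; rewrite shift_invN mulN1r.
  by apply: cvgMl_tmp; apply: cvg_hurwitz_mzv => //; exact: admissible_rev_take.
have pos_cvg j : qsym [seq shift_inv s n | n <- positives N] (drop j k)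
    @[N --> \oo] --> hurwitz_mzv (drop j k) s.
  by apply: cvg_hurwitz_mzv => //; exact: admissible_drop.
apply: cvg_unique (cvg_multitangent s_lt k_idx k_first k_last) => //.
rewrite /multitangent_reg.
under eq_bigr do rewrite !hurwitz_mzv_reg_admissible ?admissible_drop ?admissible_rev_take //.
under [X in _ + X]eq_bigr do
  rewrite !hurwitz_mzv_reg_admissible ?admissible_drop ?admissible_rev_take //.
rewrite (funext (fun N => qsym_two_sided_positives (shift_inv s) k N)).
apply: cvgD; apply: cvg_bigsum => j; first exact: cvgM.
rewrite [(-1) ^+ _ / _]mulrC -[X in X * _]mulrA.
apply: cvgM => //; rewrite /shift_inv add0r exprVn.
by apply: cvgMl_tmp.
Qed.

End Limits.

Theorem corollary3p5 (R : realType) (k : seq nat)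
    (k_index : is_index k)
    (k_first : (2 <= head 0 k)%N) (k_last : (2 <= last 0 k)%N) :
  forall s : R[i], s != 0 -> `|complex.Re s| < 2^-1 ->
    (forall T : R[i], multitangent_reg T k s = multitangent k s) /\
    (forall T T' : R[i], multitangent_reg T k s = multitangent_reg T' k s).
Proof.
move=> s _ s_lt; split=> [T|T T'].
  exact: multitangent_reg_eq.
by rewrite !multitangent_reg_eq.
Qed.
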